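(* Let $(U,\gamma,g)$ be a geometric structure, and let $h$ be a gauge metric field for $g$, i.e. a smooth field of invertible linear maps $h:V\to V$ on $U$ with $g=h^{\dagger}\circ\eta\circ h$, where $\eta$ is a (constant) orthogonal metric with the same signature as $g$. Let ${}_g\mathcal D^{+}$ be the covariant derivative of $(U,\gamma,g)$, and let ${}_\eta\mathcal D^{+}$ be its $h$-deformation, defined for vector fields $a$ and multivector fields $X$ by $${}_\eta\mathcal D_a^{+}X=\underline h\big({}_g\mathcal D_a^{+}\,\underline h^{-1}(X)\big),$$ which is the covariant derivative of a geometric structure with metric extensor $\eta$. Let ${}_gR$ and ${}_\eta R$ be the Riemann fields of these two structures. Then for every bivector field $B$ on $U$, $${}_gR(B)=\underline h^{\dagger}\big({}_\eta R(B)\big).$$ In particular, if ${}_\eta R=0$ then ${}_gR=0$.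
   Context: Setting. $V$ is a real $n$-dimensional vector space with a fixed Euclidean scalar product ''$\cdot$'' (one may take $\mathbb R^n$), and $U\subset V$ is an open set (the image of a chart domain of a smooth manifold). Vector (multivector) fields on $U$ are smooth maps $U\to V$ (resp. $U\to\bigwedge V$); $a\cdot\partial_o$ denotes the ordinary directional derivative along a vector field $a$, and $[a,b]=a\cdot\partial_o b-b\cdot\partial_o a$. The scalar product is extended to $\bigwedge V$ so that $(a\wedge b)\cdot(c\wedge d)=(a\cdot c)(b\cdot d)-(a\cdot d)(b\cdot c)$. For a linear map $t:V\to V$, $\underline t$ is its extension to $\bigwedge V$ as an exterior algebra homomorphism, $t^{\dagger}$ is the adjoint with respect to ''$\cdot$'', and $\underline t^{\dagger}$ is the extension of $t^{\dagger}$. Geometric structure. A metric extensor field $g$ on $U$ is a smooth field of invertible linear maps $g:V\to V$ with $g=g^{\dagger}$; put $a\underset{g}{\cdot}b=g(a)\cdot b$. A connection field $\gamma$ is a smooth field of bilinear maps $V\times V\to V$. Its covariant derivative is $\mathcal D_a^{+}b=a\cdot\partial_o b+\gamma(a,b)$ on vector fields, extended to multivector fields as a derivation of the exterior product with $\mathcal D_a^{+}f=a\cdot\partial_o f$ on scalar fields. $(U,\gamma,g)$ is a geometric structure if $\mathcal D^{+}$ is $g$-compatible: $a\cdot\partial_o(b\underset{g}{\cdot}c)=(\mathcal D_a^{+}b)\underset{g}{\cdot}c+b\underset{g}{\cdot}(\mathcal D_a^{+}c)$ for all vector fields $a,b,c$. Curvature. The curvature field is $\rho(a,b,c)=\mathcal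 D_a^{+}\mathcal D_b^{+}c-\mathcal D_b^{+}\mathcal D_a^{+}c-\mathcal D_{[a,b]}^{+}c$. The Riemann field is the smooth field of linear maps $R:\bigwedge^2V\to\bigwedge^2V$ determined by $R(a\wedge b)\cdot(c\wedge d)=-\rho(a,b,c)\underset{g}{\cdot}d$ for all vector fields $a,b,c,d$. A structure is called flat if its Riemann field vanishes. An orthogonal metric $\eta$ is a constant linear map $V\to V$ with $\eta=\eta^{\dagger}=\eta^{-1}$. *)

(* Defs.v *)
From HB Require Import structures.
From mathcomp Require Import all_boot all_order all_algebra.
From mathcomp Require Import all_classical all_reals all_analysis.

Set Implicit Arguments.
Unset Strict Implicit.
Unset Printing Implicit Defensive.

Import Order.TTheory GRing.Theory Num.Theory.
Import numFieldNormedType.Exports.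
Local Open Scope classical_set_scope.
Local Open Scope ring_scope.

(* V is 'cV[R]_n with its standard scalar product; a linear map of V is a
   matrix acting on the left of columns, and its adjoint is the transpose.
   A field on an open set U is a total function on V of which only the values
   on U matter. *)

Section Smooth.
Context {R : realType} {V W : normedModType R}.

Fixpoint Ck (k : nat) (U : set V) (f : V -> W) : Prop :=
  if k is k'.+1 then
    (forall x, U x -> differentiable f x) /\
    (forall v, Ck k' U (fun x => 'D_v f x))
  else forall x, U x -> {for x, continuous f}.

Definition smooth (U : set V) (f : V -> W) : Prop := forall k, Ck k U f.

End Smooth.

(* The exterior algebra of V: a multivector is the column of its coordinates
   on the blades e_S = e_i1 /\ ... /\ e_ik, S = {i1 < ... < ik}. *)
Notation mvec R n := 'cV[R]_#|{set 'I_n}|.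

Section Exterior.
Context {R : realType} {n : nat}.
Implicit Types (S A B : {set 'I_n}) (X Y : mvec R n) (t : 'M[R]_n).

Definition coef X S : R := X (enum_rank S) 0.

Definition blade S : mvec R n := delta_mx (enum_rank S) 0.

Definition scal (c : R) : mvec R n := c *: blade finset.set0.

Definition vect (v : 'cV[R]_n) : mvec R n :=
  \sum_i v i 0 *: blade (finset.set1 i).

(* number of transpositions needed to sort the concatenation of the
   increasing enumerations of A and B *)
Definition inversions A B : nat :=
  #|[pred p : 'I_n * 'I_n | [&& p.1 \in A, p.2 \in B & (p.2 < p.1)%N]]|.

Definition wedge X Y : mvec R n :=
  \sum_(A : {set 'I_n}) \sum_(B : {set 'I_n} | [disjoint A & B])
    ((-1) ^+ inversions A B * coef X A * coef Y B) *: blade (A :|: B).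

(* the e_S are orthonormal; on 2-blades this is
   (a /\ b) . (c /\ d) = (a . c)(b . d) - (a . d)(b . c) *)
Definition mdot X Y : R := \sum_(S : {set 'I_n}) coef X S * coef Y S.

(* the algebra homomorphism extending t sends
   e_i1 /\ ... /\ e_ik to t(e_i1) /\ ... /\ t(e_ik) *)
Definition outer t X : mvec R n :=
  \sum_(S : {set 'I_n}) coef X S *: \big[wedge/scal 1]_(i <- enum S) vect (col i t).

Definition bivector X : Prop := forall S, #|S| != 2%N -> coef X S = 0.

Definition vdot (a b : 'cV[R]_n) : R := \sum_i a i 0 * b i 0.

Definition gdot (g : 'M[R]_n) (a b : 'cV[R]_n) : R := vdot (g *m a) b.

(* p positive and q negative eigenvalues, counted with multiplicity *)
Definition has_signature (A : 'M[R]_n) (p q : nat) : Prop :=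
  exists s : seq R,
    [/\ char_poly A = \prod_(l <- s) ('X - l%:P),
        p = count (fun l => 0 < l) s & q = count (fun l => l < 0) s].

Definition same_signature (A B : 'M[R]_n) : Prop :=
  exists p q : nat, has_signature A p q /\ has_signature B p q.

(* invmx is the identity outside unitmx, hence the first clause *)
Definition orthogonal_metric (eta : 'M[R]_n) : Prop :=
  [/\ eta \in unitmx, eta^T = eta & invmx eta = eta].

End Exterior.

Section Geometry.
Context {R : realType} {n : nat}.
Local Notation V := 'cV[R]_n.
Implicit Types (U : set V) (g h : V -> 'M[R]_n) (gamma : V -> V -> V -> V)
  (a b c d : V -> V).

Definition metric_extensor_field U g : Prop :=
  smooth U g /\ forall x, U x -> g x \in unitmx /\ (g x)^T = g x.

(* gamma x u v is the value at x of the bilinear field; smoothness of the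
   field is that of its values on constant arguments *)
Definition connection_field U gamma : Prop :=
  (forall x, U x -> bilinear_for *:%R *:%R (gamma x)) /\
  (forall u v : V, smooth U (fun x => gamma x u v)).

Definition cov_vec gamma a b : V -> V :=
  fun x => 'D_(a x) b x + gamma x (a x) (b x).

Definition compatible U gamma g : Prop :=
  forall a b c, smooth U a -> smooth U b -> smooth U c ->
  forall x, U x ->
    'D_(a x) (fun y => gdot (g y) (b y) (c y)) x =
      gdot (g x) (cov_vec gamma a b x) (c x) +
      gdot (g x) (b x) (cov_vec gamma a c x).

Record geometric_structure U gamma g : Prop := GeometricStructure {
  gs_connection : connection_field U gamma;
  gs_metric : metric_extensor_field U g;
  gs_compatible : compatible U gamma g }.

(* D is the covariant derivative of gamma on multivector fields; these clauses
   determine (D a X) on U for smooth a and X. *)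
Record covariant_derivative U gamma
    (D : (V -> V) -> (V -> mvec R n) -> V -> mvec R n) : Prop :=
  CovariantDerivative {
  cov_scal : forall a (f : V -> R), smooth U a -> smooth U f ->
    forall x, U x ->
      D a (fun y => scal (f y)) x = scal ('D_(a x) f x);
  cov_vect : forall a b, smooth U a -> smooth U b ->
    forall x, U x ->
      D a (fun y => vect (b y)) x = vect (cov_vec gamma a b x);
  cov_add : forall a (X Y : V -> mvec R n),
    smooth U a -> smooth U X -> smooth U Y ->
    forall x, U x ->
      D a (fun y => X y + Y y) x = D a X x + D a Y x;
  cov_wedge : forall a (X Y : V -> mvec R n),
    smooth U a -> smooth U X -> smooth U Y ->
    forall x, U x ->
      D a (fun y => wedge (X y) (Y y)) x =
        wedge (D a X x) (Y x) + wedge (X x) (D a Y x) }.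

Definition lie_bracket a b : V -> V :=
  fun x => 'D_(a x) b x - 'D_(b x) a x.

Definition curvature gamma a b c : V -> V :=
  fun x => cov_vec gamma a (cov_vec gamma b c) x
         - cov_vec gamma b (cov_vec gamma a c) x
         - cov_vec gamma (lie_bracket a b) c x.

(* Rm is a field of linear maps between spaces of bivectors; its values on
   multivectors that are not bivectors are irrelevant. *)
Record riemann_field U gamma g (Rm : V -> mvec R n -> mvec R n) : Prop :=
  RiemannField {
  riemann_bivector : forall x B, U x -> bivector B -> bivector (Rm x B);
  riemann_linear : forall x (k : R) B C, U x -> bivector B -> bivector C ->
    Rm x (k *: B + C) = k *: Rm x B + Rm x C;
  riemann_smooth : forall B, bivector B -> smooth U (fun x => Rm x B);
  riemann_curvature : forall a b c d,
    smooth U a -> smooth U b -> smooth U c -> smooth U d ->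
    forall x, U x ->
      mdot (Rm x (wedge (vect (a x)) (vect (b x))))
           (wedge (vect (c x)) (vect (d x))) =
        - gdot (g x) (curvature gamma a b c x) (d x) }.

Definition flat U (Rm : V -> mvec R n -> mvec R n) : Prop :=
  forall x B, U x -> bivector B -> Rm x B = 0.

Definition gauge_metric_field U g h (eta : 'M[R]_n) : Prop :=
  [/\ smooth U h,
      forall x, U x -> h x \in unitmx,
      orthogonal_metric eta,
      forall x, U x -> same_signature eta (g x) &
      forall x, U x -> g x = (h x)^T *m eta *m h x].

Definition deformation h
    (D : (V -> V) -> (V -> mvec R n) -> V -> mvec R n)
    a (X : V -> mvec R n) : V -> mvec R n :=
  fun x => outer (h x) (D a (fun y => outer (invmx (h y)) (X y)) x).

End Geometry.

(* Main.v *)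
Require Import Defs.
From HB Require Import structures.
From mathcomp Require Import all_boot all_order all_algebra.
From mathcomp Require Import all_classical all_reals all_analysis.
From mathcomp Require Import ring.

Import Order.TTheory GRing.Theory Num.Theory.
Import numFieldNormedType.Exports.
Local Open Scope classical_set_scope.
Local Open Scope ring_scope.

(* The h-deformed derivative of a vector field is h (D_a (h^-1 b)), so the
   curvature of the deformed connection on (a, b, h c) is h applied to the
   curvature of the original one on (a, b, c).  Pairing with d and using
   g = h^T eta h gives Rg(a /\ b) . (c /\ d) = Reta(a /\ b) . (hc /\ hd), and
   the right-hand side is (outer h^T (Reta(a /\ b))) . (c /\ d) by
   adjointness.  That the deformation is again a derivation of the exterior
   product rests on outer h being an algebra morphism, which in coordinates is
   the sorting of products of anticommuting vectors. *)

(** * Exterior algebra in blade coordinates *)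

(** Two constraints shape the development. The derivative [D] and the connection [gamma_eta] are
    known only through clauses about smooth fields, read at points of U. Every intermediate field
    (h^-1 b, its multivector analogue, covariant derivatives fed to another covariant derivative)
    must therefore be shown smooth, and two fields that agree on U alone must be interchangeable
    under derivatives. This is why the calculus of [Ck] is built up to equality on an open set.
    Further, curvature is an operator on fields, while the claim is pointwise. Linearity of a
    Riemann field at x reduces the claim to products of constant vectors, but h c varies with the
    point even when c is constant, so the comparison of curvatures has to be made for fields. *)

Section ExteriorAlgebra.
Context {R : realType} {n : nat}.
Implicit Types (S A B C : {set 'I_n}) (X Y Z : mvec R n) (s t : 'M[R]_n) (a b c
  d u v : 'cV[R]_n).

Lemma coefD X Y S : coef (X + Y) S = coef X S + coef Y S.
Proof. by rewrite /coef mxE. Qed.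

Lemma coefZ (k : R) X S : coef (k *: X) S = k * coef X S.
Proof. by rewrite /coef mxE. Qed.

Lemma coef0 S : coef (0 : mvec R n) S = 0.
Proof. by rewrite /coef mxE. Qed.

Lemma coef_sum I (r : seq I) P (F : I -> mvec R n) S :
  coef (\sum_(i <- r | P i) F i) S = \sum_(i <- r | P i) coef (F i) S.
Proof. by rewrite /coef summxE. Qed.

Lemma coef_blade A S : coef (blade A : mvec R n) S = (S == A)%:R.
Proof. by rewrite /coef /blade mxE eqxx andbT (inj_eq enum_rank_inj). Qed.

Lemma coefP X Y : (forall S, coef X S = coef Y S) <-> X = Y.
Proof.
split=> [XY|-> //]; apply/matrixP=> i j; rewrite ord1.
by have := XY (enum_val i); rewrite /coef enum_valK.
Qed.

Lemma blade_sum X : X = \sum_S coef X S *: blade S.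
Proof.
apply/coefP=> S; rewrite coef_sum (bigD1 S)//= coefZ coef_blade eqxx mulr1.
by rewrite big1 ?addr0// => A AS; rewrite coefZ coef_blade eq_sym (negbTE AS) mulr0.
Qed.

Lemma wedgeDl X Y Z : wedge (X + Y) Z = wedge X Z + wedge Y Z.
Proof.
rewrite /wedge -big_split; apply: eq_bigr => A _ /=.
rewrite -big_split; apply: eq_bigr => B _ /=.
by rewrite coefD mulrDr mulrDl scalerDl.
Qed.

Lemma wedgeDr X Y Z : wedge X (Y + Z) = wedge X Y + wedge X Z.
Proof.
rewrite /wedge -big_split; apply: eq_bigr => A _ /=.
rewrite -big_split; apply: eq_bigr => B _ /=.
by rewrite coefD mulrDr scalerDl.
Qed.

Lemma wedgeZl (k : R) X Y : wedge (k *: X) Y = k *: wedge X Y.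
Proof.
rewrite /wedge scaler_sumr; apply: eq_bigr => A _.
rewrite scaler_sumr; apply: eq_bigr => B _.
by rewrite coefZ scalerA !mulrA; congr (_ * _ * _ *: _); rewrite mulrC.
Qed.

Lemma wedgeZr (k : R) X Y : wedge X (k *: Y) = k *: wedge X Y.
Proof.
rewrite /wedge scaler_sumr; apply: eq_bigr => A _.
rewrite scaler_sumr; apply: eq_bigr => B _.
by rewrite coefZ scalerA mulrCA.
Qed.

Lemma wedge0l X : wedge 0 X = 0.
Proof. by have := wedgeZl 0 0 X; rewrite !scale0r. Qed.

Lemma wedge0r X : wedge X 0 = 0.
Proof. by have := wedgeZr 0 X 0; rewrite !scale0r. Qed.

Lemma wedge_suml I (r : seq I) P (F : I -> mvec R n) Y :
  wedge (\sum_(i <- r | P i) F i) Y = \sum_(i <- r | P i) wedge (F i) Y.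
Proof.
by rewrite (big_morph (wedge^~ Y) (fun X1 X2 => wedgeDl X1 X2 Y) (wedge0l Y)).
Qed.

Lemma wedge_sumr I (r : seq I) P (F : I -> mvec R n) X :
  wedge X (\sum_(i <- r | P i) F i) = \sum_(i <- r | P i) wedge X (F i).
Proof. by rewrite (big_morph (wedge X) (wedgeDr X) (wedge0r X)). Qed.

Lemma wedge_blade A B : wedge (blade A) (blade B : mvec R n) =
  if [disjoint A & B] then (-1) ^+ inversions A B *: blade (A :|: B) else 0.
Proof.
rewrite /wedge (bigD1 A)//= [X in _ + X]big1 ?addr0; last first.
  move=> A' A'A; apply: big1 => B' _.
  by rewrite coef_blade (negbTE A'A) mulr0 mul0r scale0r.
rewrite big_mkcond /= (bigD1 B)//= big1 ?addr0; last first.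
  move=> B' B'B; case: ifP => // _.
  by rewrite (coef_blade B) (negbTE B'B) mulr0 scale0r.
by rewrite !coef_blade !eqxx !mulr1.
Qed.

(** As a double sum, the count is visibly additive over disjoint unions in either set; all sign
    rules come from this. *)
Lemma inversionsE A B :
  inversions A B = (\sum_(i in A) \sum_(j in B) (j < i))%N.
Proof.
rewrite /inversions -sum1_card pair_big /= [RHS]big_mkcond [LHS]big_mkcond /=.
apply: eq_bigr => -[i j] _ /=; rewrite inE /=.
by case: (i \in A); case: (j \in B); case: (j < i)%N.
Qed.

Lemma inversionsUl A B C : [disjoint A & B]%B ->
  inversions (A :|: B) C = (inversions A C + inversions B C)%N.
Proof.
move=> dAB; rewrite !inversionsE -bigU//=.
by apply: eq_bigl => i; rewrite !inE.
Qed.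

Lemma inversionsUr A B C : [disjoint B & C]%B ->
  inversions A (B :|: C) = (inversions A B + inversions A C)%N.
Proof.
move=> dBC; rewrite !inversionsE -big_split; apply: eq_bigr => i _ /=.
by rewrite -bigU//=; apply: eq_bigl => j; rewrite !inE.
Qed.

Lemma inversions0l A : inversions finset.set0 A = 0%N.
Proof. by rewrite inversionsE big_set0. Qed.

Lemma inversions0r A : inversions A finset.set0 = 0%N.
Proof. by rewrite inversionsE big1// => i _; rewrite big_set0. Qed.

(** By trilinearity only blades matter. Either bracketing vanishes unless the three sets are
    pairwise disjoint, and then both exponents add up the inversions of the three pairs (A,B), (A,C)
    and (B,C). *)
Lemma wedgeA : associative (@wedge R n).
Proof.
move=> X Y Z.
rewrite (blade_sum X) !(wedge_suml _ _ _ (fun A => coef X A *: blade A)).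
rewrite [RHS]wedge_suml; apply: eq_bigr => A _.
rewrite !wedgeZl; congr (_ *: _).
rewrite (blade_sum Y) (wedge_suml _ _ _ (fun B => coef Y B *: blade B)).
rewrite (wedge_sumr _ _ _ (fun B => coef Y B *: blade B)).
rewrite [LHS]wedge_sumr [RHS]wedge_suml; apply: eq_bigr => B _.
rewrite !(wedgeZl, wedgeZr); congr (_ *: _).
rewrite (blade_sum Z) !(wedge_sumr _ _ _ (fun C => coef Z C *: blade C)).
rewrite [LHS]wedge_sumr; apply: eq_bigr => C _.
rewrite !wedgeZr; congr (_ *: _).
rewrite !wedge_blade 2!fun_if /= -!setI_eq0.
rewrite (fun_if (wedge^~ (blade C))) wedge0l wedge0r.
rewrite !(wedgeZl, wedgeZr) !wedge_blade -!setI_eq0 finset.setIUl finset.setIUr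
  !finset.setU_eq0.
have [AB|_] := boolP (A :&: B == finset.set0); have [BC|_] := boolP (B :&: C ==
  finset.set0);
  rewrite ?andbF ?scaler0//= ?andbT.
case: ifP => _; rewrite ?scaler0// !scalerA -!exprD finset.setUA.
rewrite inversionsUl; last by rewrite -setI_eq0.
rewrite inversionsUr; last by rewrite -setI_eq0.
by rewrite addnC !addnA.
Qed.

Lemma wedge1l : left_id (scal 1) (@wedge R n).
Proof.
move=> X; rewrite /scal scale1r {1}(blade_sum X) wedge_sumr [RHS]blade_sum.
apply: eq_bigr => A _; rewrite wedgeZr wedge_blade.
by rewrite -setI_eq0 finset.set0I eqxx inversions0l scale1r finset.set0U.
Qed.

Lemma wedge1r : right_id (scal 1) (@wedge R n).
Proof.
move=> X; rewrite /scal scale1r {1}(blade_sum X) wedge_suml [RHS]blade_sum.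
apply: eq_bigr => A _; rewrite wedgeZl wedge_blade.
by rewrite -setI_eq0 finset.setI0 eqxx inversions0r scale1r finset.setU0.
Qed.

(** Makes the splitting of iterated products, [big_cat], available for [wedge]. *)
HB.instance Definition _ := Monoid.isLaw.Build (mvec R n) (scal 1) (@wedge R n)
  wedgeA wedge1l wedge1r.


(** * Vectors as multivectors, and their anticommutation *)

Lemma vectD u v : vect (u + v) = vect u + vect v.
Proof.
by rewrite /vect -big_split; apply: eq_bigr => i _; rewrite mxE scalerDl.
Qed.

Lemma vectZ (k : R) u : vect (k *: u) = k *: vect u.
Proof.
by rewrite /vect scaler_sumr; apply: eq_bigr => i _; rewrite mxE scalerA.
Qed.

Lemma coef_vect u i : coef (vect u) (finset.set1 i) = u i 0.
Proof.
rewrite /vect coef_sum (bigD1 i)//= coefZ coef_blade eqxx mulr1.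
rewrite big1 ?addr0// => j ji; rewrite coefZ coef_blade.
by rewrite (inj_eq finset.set1_inj) eq_sym (negbTE ji) mulr0.
Qed.

Lemma vect_inj : injective (@vect R n).
Proof.
by move=> u v uv; apply/colP => i; rewrite -!coef_vect uv.
Qed.

Lemma inversions1 (i j : 'I_n) :
  inversions (finset.set1 i) (finset.set1 j) = (j < i)%N.
Proof. by rewrite inversionsE !big_set1. Qed.

Lemma wedge_blade1C (i j : 'I_n) :
  wedge (blade (finset.set1 i)) (blade (finset.set1 j)) =
  - wedge (blade (finset.set1 j)) (blade (finset.set1 i) : mvec R n).
Proof.
rewrite !wedge_blade !disjoints1 !inE (eq_sym j) !inversions1 finset.setUC.
have [->|ij] := eqVneq i j; first by rewrite oppr0.
by case: ltngtP (ij : (i != j :> nat)) => //= _ _;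
  rewrite ?expr0 ?expr1 ?scale1r ?scaleN1r ?opprK.
Qed.

Lemma wedge_vectC u v : wedge (vect u) (vect v) = - wedge (vect v) (vect u).
Proof.
rewrite /vect (wedge_suml _ _ _ (fun i => u i 0 *: blade _)).
rewrite (wedge_suml _ _ _ (fun i => v i 0 *: blade _)) -sumrN.
under eq_bigr do rewrite wedge_sumr.
under [RHS]eq_bigr do rewrite wedge_sumr -sumrN.
rewrite exchange_big; apply: eq_bigr => j _; apply: eq_bigr => i _ /=.
by rewrite !wedgeZl !wedgeZr wedge_blade1C !scalerN !scalerA mulrC.
Qed.

Lemma vect_sum I (r : seq I) P (F : I -> 'cV[R]_n) :
  vect (\sum_(i <- r | P i) F i) = \sum_(i <- r | P i) vect (F i).
Proof.
apply: (big_morph _ vectD).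
by have := vectZ 0 0; rewrite !scale0r.
Qed.

Lemma wedge_vectvv u : wedge (vect u) (vect u) = 0.
Proof.
have /eqP := wedge_vectC u u; rewrite -addr_eq0 -mulr2n.
by rewrite -scaler_nat scaler_eq0 pnatr_eq0 => /eqP.
Qed.

(** * Sorting products of anticommuting vectors *)

Definition wedge_vects (w : 'I_n -> 'cV[R]_n) (s : seq 'I_n) : mvec R n :=
  \big[@wedge R n/scal 1]_(i <- s) vect (w i).

Lemma wedge_vects_cat w (r1 r2 : seq 'I_n) :
  wedge_vects w (r1 ++ r2) = wedge (wedge_vects w r1) (wedge_vects w r2).
Proof. by rewrite /wedge_vects big_cat. Qed.

Lemma wedge_vects_cons w i (r : seq 'I_n) :
  wedge_vects w (i :: r) = wedge (vect (w i)) (wedge_vects w r).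
Proof. by rewrite /wedge_vects big_cons. Qed.

Lemma wedge_vects_comm w i (s : seq 'I_n) :
  wedge (vect (w i)) (wedge_vects w s) =
  (-1) ^+ size s *: wedge (wedge_vects w s) (vect (w i)).
Proof.
rewrite /wedge_vects; elim: s => [|j s IHs].
  by rewrite big_nil wedge1l wedge1r scale1r.
rewrite big_cons wedgeA (wedge_vectC (w i)) -scaleN1r wedgeZl -wedgeA IHs.
by rewrite wedgeZr wedgeA scalerA /= exprS.
Qed.

Let ltI : rel 'I_n := fun i j => (i < j)%N.

Let ltI_trans : transitive ltI.
Proof. by move=> x y z; exact: ltn_trans. Qed.

Lemma sorted_enum_set A : sorted ltI (enum A).
Proof.
apply: (sorted_filter ltI_trans); rewrite -enumT.
by rewrite -(@sorted_map _ _ (val : 'I_n -> nat) ltn) val_enum_ord iota_ltn_sorted.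
Qed.

(** A strictly increasing list is determined by its elements. The hypothesis is in [pairwise] form
    because that splits over concatenations. *)
Lemma eq_enum_set A (r : seq 'I_n) :
  pairwise ltI r -> r =i A -> enum A = r.
Proof.
move=> rs rA; apply: (irr_sorted_eq ltI_trans) => //.
- by move=> x; exact: ltnn.
- exact: sorted_enum_set.
- by rewrite (sorted_pairwise ltI_trans).
- by move=> x; rewrite mem_enum rA.
Qed.

Section EnumSplit.
Variables (i : 'I_n) (A : {set 'I_n}).
Hypothesis iA : i \notin A.
Let lo := [seq j : 'I_n <- enum A | (j < i)%N].
Let hi := [seq j : 'I_n <- enum A | (i < j)%N].

Let pw (P : pred 'I_n) : pairwise ltI (seq.filter P (enum A)).
Proof.
by rewrite -(sorted_pairwise ltI_trans) (sorted_filter ltI_trans)// sorted_enum_set.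
Qed.

Lemma enum_set_split : enum A = lo ++ hi.
Proof.
apply: eq_enum_set.
  rewrite pairwise_cat !pw !andbT; apply/allrelP => x y.
  by rewrite [x \in lo]mem_filter [y \in hi]mem_filter => /andP[xi _] /andP[iy
    _] /=; exact: ltn_trans iy.
move=> x; rewrite mem_cat [x \in lo]mem_filter [x \in hi]mem_filter !mem_enum
  -andb_orl -neq_ltn.
have [xA|_] := boolP (x \in A); rewrite ?andbF// andbT.
by apply: contraNneq iA => /val_inj <-.
Qed.

Lemma enum_setU1_split : enum (i |: A) = lo ++ i :: hi.
Proof.
apply: eq_enum_set.
  rewrite -cat_rcons pairwise_cat pw -cats1 pairwise_cat pw /= !andbT.
  apply/andP; split; apply/allrelP => x y; last first.
    by rewrite mem_filter inE => /andP[xi _] /eqP ->.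
  rewrite mem_cat inE [x \in lo]mem_filter [y \in hi]mem_filter =>
    /orP[/andP[xi _]|/eqP ->] /andP[iy _] //=.
  exact: ltn_trans iy.
move=> x; rewrite mem_cat !inE [x \in lo]mem_filter [x \in hi]mem_filter !mem_enum.
have [->|xi] := eqVneq x i; first by rewrite orbT.
by rewrite !orFb -andb_orl -neq_ltn xi.
Qed.

(** These are the factors that the vector of index i passes on its way from the front to its sorted
    place, hence the sign in [wedge_vects1]. *)
Lemma size_lo : size lo = inversions (finset.set1 i) A.
Proof.
rewrite inversionsE big_set1 size_filter -sum1_count big_enum_cond /=.
by rewrite [RHS]big_mkcond [LHS]big_mkcond; apply: eq_bigr => j _; case: (j \in
  A); case: ltnP.
Qed.

End EnumSplit.

(** Moving the new factor rightwards past the smaller indices costs one sign each. If i already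
    occurs in A, the move brings two equal vectors together and the product vanishes. *)
Lemma wedge_vects1 w i A :
  wedge (vect (w i)) (wedge_vects w (enum A)) =
  if i \in A then 0
  else (-1) ^+ inversions (finset.set1 i) A *: wedge_vects w (enum (i |: A)).
Proof.
case: ifPn => iA.
  have iB : i \notin A :\ i by rewrite !inE eqxx.
  rewrite -(finset.setD1K iA) enum_setU1_split// wedge_vects_cat wedge_vects_cons.
  rewrite wedgeA wedge_vects_comm wedgeZl -wedgeA (wedgeA (vect _) (vect _)).
  by rewrite wedge_vectvv wedge0l wedge0r scaler0.
rewrite enum_setU1_split// {1}(enum_set_split _ _ iA) !wedge_vects_cat.
by rewrite wedge_vects_cons wedgeA wedge_vects_comm wedgeZl -wedgeA size_lo.
Qed.

Lemma scale_signK (k : nat) X : (-1) ^+ k *: ((-1) ^+ k *: X) = X.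
Proof. by rewrite scalerA -expr2 sqrr_sign scale1r. Qed.

(** The multiplication rule of [wedge_blade], with arbitrary vectors in place of the basis: this is
    what makes [outer] multiplicative. By induction on the size of A, any element i is pulled to the
    front of A, the rest is merged with B, and i is then inserted into the union. *)
Lemma wedge_vects_set w A B :
  wedge (wedge_vects w (enum A)) (wedge_vects w (enum B)) =
  if [disjoint A & B]%B
  then (-1) ^+ inversions A B *: wedge_vects w (enum (A :|: B)) else 0.
Proof.
elim: {A}#|A| {-2}A (erefl #|A|) => [|k IHk] A.
  move/eqP; rewrite cards_eq0 => /eqP ->.
  rewrite -setI_eq0 finset.set0I eqxx inversions0l scale1r finset.set0U.
  by rewrite finset.enum_set0 /wedge_vects big_nil wedge1l.
move=> cA; have /card_gt0P[i iA] : (0 < #|A|)%N by rewrite cA.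
set A' := A :\ i.
have iA' : i \notin A' by rewrite !inE eqxx.
have dA' : [disjoint [set i]%SET & A']%B by rewrite disjoints1.
have cA' : #|A'| = k by move: cA; rewrite (cardsD1 i) iA => -[].
have WA : wedge_vects w (enum A) =
    (-1) ^+ inversions [set i]%SET A' *: wedge (vect (w i)) (wedge_vects w
      (enum A')).
  by rewrite wedge_vects1 (negbTE iA') scale_signK finset.setD1K.
rewrite WA wedgeZl -wedgeA IHk//.
have -> : [disjoint A & B]%B = (i \notin B) && [disjoint A' & B]%B.
  by rewrite -(finset.setD1K iA) -!setI_eq0 finset.setIUl finset.setU_eq0
    setI_eq0 disjoints1.
have [dA'B|] := boolP [disjoint A' & B]%B; last by rewrite andbF wedge0r scaler0.
rewrite wedgeZr wedge_vects1 inE (negbTE iA') andbT /=.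
case: ifP => iB; rewrite ?scaler0//= finset.setUA finset.setD1K//.
have -> : inversions A B = (inversions [set i]%SET B + inversions A' B)%N.
  by rewrite -{1}(finset.setD1K iA) inversionsUl.
(* Inserting i into the union of A' and B passes the elements of A' again, which cancels the sign of
   pulling i out of A; the inversions of i with B and of A' with B remain. *)
rewrite (inversionsUr _ _ _ dA'B) [in LHS]exprD -[(_ * _) *: _]scalerA.
rewrite (scalerA ((-1) ^+ inversions A' B)) [X in _ *: (X *: _)]mulrC.
by rewrite -scalerA scale_signK scalerA -exprD addnC.
Qed.

(** * The exterior extension of a linear map as an algebra morphism *)

Lemma outer_blade t A : outer t (blade A) = wedge_vects (fun i => col i t) (enum A).
Proof.
rewrite /outer (bigD1 A)//= coef_blade eqxx scale1r [X in _ + X]big1 ?addr0//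
  => B BA.
by rewrite coef_blade (negbTE BA) scale0r.
Qed.

Lemma outerD t X Y : outer t (X + Y) = outer t X + outer t Y.
Proof.
by rewrite /outer -big_split; apply: eq_bigr => S _; rewrite coefD scalerDl.
Qed.

Lemma outerZ t (k : R) X : outer t (k *: X) = k *: outer t X.
Proof.
by rewrite /outer scaler_sumr; apply: eq_bigr => S _; rewrite coefZ scalerA.
Qed.

Lemma outer0 t : outer t (0 : mvec R n) = 0.
Proof. by have := outerZ t 0 0; rewrite !scale0r. Qed.

Lemma outer_sum t I (r : seq I) P (F : I -> mvec R n) :
  outer t (\sum_(i <- r | P i) F i) = \sum_(i <- r | P i) outer t (F i).
Proof. by rewrite (big_morph (outer t) (outerD t) (outer0 t)). Qed.

Lemma outer_wedge t X Y : outer t (wedge X Y) = wedge (outer t X) (outer t Y).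
Proof.
rewrite (blade_sum X) (wedge_suml _ _ _ (fun A => coef X A *: blade A)).
rewrite !outer_sum [RHS]wedge_suml; apply: eq_bigr => A _.
rewrite (blade_sum Y) (wedge_sumr _ _ _ (fun B => coef Y B *: blade B)).
rewrite !outer_sum [RHS]wedge_sumr; apply: eq_bigr => B _.
rewrite wedgeZl wedgeZr !outerZ wedgeZl wedgeZr; do 2 congr (_ *: _).
rewrite wedge_blade !outer_blade wedge_vects_set (fun_if (outer t)) outer0 outerZ.
by rewrite outer_blade.
Qed.

Lemma outer_scal t (k : R) : outer t (scal k) = scal k.
Proof.
by rewrite /scal outerZ outer_blade finset.enum_set0 /wedge_vects big_nil /scal
  scale1r.
Qed.

Lemma outer_vect t u : outer t (vect u) = vect (t *m u).
Proof.
have -> : t *m u = \sum_i u i 0 *: col i t.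
  by apply/colP => k; rewrite summxE mxE; apply: eq_bigr => i _; rewrite !mxE mulrC.
rewrite vect_sum [vect u]/vect outer_sum; apply: eq_bigr => i _.
by rewrite outerZ outer_blade finset.enum_set1 /wedge_vects big_seq1 vectZ.
Qed.

Lemma outer_wedge_vects t w (s : seq 'I_n) :
  outer t (wedge_vects w s) = wedge_vects (fun i => t *m w i) s.
Proof.
rewrite /wedge_vects (big_morph _ (outer_wedge t) (outer_scal t 1)).
by apply: eq_bigr => i _; rewrite outer_vect.
Qed.

Lemma outerM s t X : outer (s *m t) X = outer s (outer t X).
Proof.
rewrite (blade_sum X) !(outer_sum _ _ _ _ (fun A => coef X A *: blade A)).
rewrite outer_sum; apply: eq_bigr => A _.
rewrite !outerZ !outer_blade outer_wedge_vects; congr (_ *: _).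
by rewrite /wedge_vects; apply: eq_bigr => i _; rewrite !colE mulmxA.
Qed.

Lemma vect_delta (i : 'I_n) : vect (delta_mx i 0) = blade [set i]%SET :> mvec R n.
Proof.
rewrite /vect (bigD1 i)//= mxE !eqxx scale1r big1 ?addr0// => j ji.
by rewrite mxE (negbTE ji) scale0r.
Qed.

(** The content is that the increasing product of basis vectors indexed by A is [blade A].
    Multiplicativity of [outer] lets one factor be peeled off at a time. *)
Lemma outer1 X : outer 1%:M X = X.
Proof.
rewrite [RHS]blade_sum [in LHS](blade_sum X) outer_sum; apply: eq_bigr => A _.
rewrite outerZ; congr (_ *: _).
elim: {A}#|A| {-2}A (erefl #|A|) => [|k IHk] A.
  move/eqP; rewrite cards_eq0 => /eqP ->.
  by rewrite -(scale1r (blade _)) -/(scal 1) outer_scal.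
move=> cA; have /card_gt0P[i iA] : (0 < #|A|)%N by rewrite cA.
have cA' : #|A :\ i| = k by move: cA; rewrite (cardsD1 i) iA => -[].
(* The sign compensates for i being an arbitrary element of A, not the least one. *)
have -> : blade A = (-1) ^+ inversions [set i]%SET (A :\ i) *:
    wedge (vect (delta_mx i 0)) (blade (A :\ i)) :> mvec R n.
  rewrite vect_delta wedge_blade disjoints1 !inE eqxx scale_signK.
  by rewrite finset.setD1K.
by rewrite outerZ outer_wedge outer_vect mul1mx IHk.
Qed.

(** * The scalar product, and its Gram determinant on products of two vectors *)

Lemma mdotC X Y : mdot X Y = mdot Y X.
Proof. by apply: eq_bigr => S _; rewrite mulrC. Qed.

Lemma mdotDl X Y Z : mdot (X + Y) Z = mdot X Z + mdot Y Z.
Proof.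
by rewrite /mdot -big_split; apply: eq_bigr => S _; rewrite coefD mulrDl.
Qed.

Lemma mdotZl (k : R) X Y : mdot (k *: X) Y = k * mdot X Y.
Proof.
by rewrite /mdot mulr_sumr; apply: eq_bigr => S _; rewrite coefZ mulrA.
Qed.

Lemma mdotZr (k : R) X Y : mdot X (k *: Y) = k * mdot X Y.
Proof. by rewrite mdotC mdotZl mdotC. Qed.

Lemma mdot0l X : mdot 0 X = 0.
Proof. by have := mdotZl 0 0 X; rewrite scale0r mul0r. Qed.

Lemma mdot_suml I (r : seq I) P (F : I -> mvec R n) Y :
  mdot (\sum_(i <- r | P i) F i) Y = \sum_(i <- r | P i) mdot (F i) Y.
Proof. by rewrite (big_morph (mdot^~ Y) (fun X1 X2 => mdotDl X1 X2 Y) (mdot0l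
  Y)). Qed.

Lemma mdot_sumr I (r : seq I) P (F : I -> mvec R n) X :
  mdot X (\sum_(i <- r | P i) F i) = \sum_(i <- r | P i) mdot X (F i).
Proof. by rewrite mdotC mdot_suml; apply: eq_bigr => i _; rewrite mdotC. Qed.

Lemma mdot_blade X S : mdot X (blade S) = coef X S.
Proof.
rewrite /mdot (bigD1 S)//= coef_blade eqxx mulr1 big1 ?addr0// => A AS.
by rewrite coef_blade (negbTE AS) mulr0.
Qed.

Lemma wedge_blade1 (i j : 'I_n) : i != j ->
  wedge (blade [set i]%SET) (blade [set j]%SET) =
  (-1) ^+ (j < i)%N *: blade [set i; j]%SET :> mvec R n.
Proof. by move=> ij; rewrite wedge_blade disjoints1 inE ij inversions1. Qed.

Lemma blade2 (i j : 'I_n) : i != j ->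
  blade [set i; j]%SET =
  (-1) ^+ (j < i)%N *: wedge (vect (delta_mx i 0)) (vect (delta_mx j 0)) :>
    mvec R n.
Proof. by move=> ij; rewrite !vect_delta wedge_blade1// scale_signK. Qed.

Lemma set2_eq (i j k l : 'I_n) : i != j -> k != l ->
  ([set k; l]%SET == [set i; j]%SET) =
  (i == k) && (j == l) || (i == l) && (j == k).
Proof.
move=> ij kl; apply/eqP/orP => [E|[/andP[/eqP-> /eqP->]|/andP[/eqP->
  /eqP->]]//]; last first.
  exact: finset.setUC.
have := finset.set21 i j; have := finset.set22 i j; rewrite -E !inE.
case/orP => /eqP jE; case/orP => /eqP iE.
- by rewrite iE jE eqxx in ij.
- by right; rewrite iE jE !eqxx.
- by left; rewrite iE jE !eqxx.
- by rewrite iE jE eqxx in ij.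
Qed.

Lemma sum_delta2 (F : 'I_n -> 'I_n -> R) i j :
  \sum_k \sum_l F k l * ((i == k)%:R * (j == l)%:R) = F i j.
Proof.
rewrite (bigD1 i)//= [X in _ + X]big1 ?addr0 => [|k ki]; last first.
  by apply: big1 => l _; rewrite eq_sym (negbTE ki) mul0r mulr0.
rewrite (bigD1 j)//= [X in _ + X]big1 ?addr0 => [|l lj]; last first.
  by rewrite [j == l]eq_sym (negbTE lj) !mulr0.
by rewrite !eqxx !mulr1.
Qed.

Lemma mdot_wedge_blade1 (i j k l : 'I_n) :
  mdot (wedge (blade [set i]%SET) (blade [set j]%SET))
       (wedge (blade [set k]%SET) (blade [set l]%SET) : mvec R n) =
  (i == k)%:R * (j == l)%:R - (i == l)%:R * (j == k)%:R.
Proof.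
have [<-|ij] := eqVneq i j.
  by rewrite -!vect_delta wedge_vectvv mdot0l mulrC subrr.
have [<-|kl] := eqVneq k l.
  by rewrite -!vect_delta wedge_vectvv mdotC mdot0l subrr.
rewrite !wedge_blade1// mdotZl mdotZr mdot_blade coef_blade.
rewrite set2_eq//; have [ik|ik] := eqVneq i k; have [jl|jl] := eqVneq j l => /=.
- by rewrite -ik -jl (negbTE ij) mul0r subr0 !mulr1 -expr2 sqrr_sign.
- by rewrite ik (negbTE kl) /= !mulr0 mul0r subr0.
- by rewrite jl [l == k]eq_sym (negbTE kl) andbF !mulr0 mul0r subr0.
have [il|il] := eqVneq i l; have [jk|jk] := eqVneq j k => /=; rewrite ?mulr0
  ?mul0r ?subr0//.
(* Transposed pair: exactly one of i < j and j < i holds, so the two sorting signs multiply to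
   -1. *)
rewrite -il -jk !mul1r mulr1 sub0r.
by case: ltngtP (ij : (i != j :> nat)) => //= _ _; rewrite ?mul1r ?mulr1.
Qed.

Lemma wedge_vect_expand u v : wedge (vect u) (vect v) =
  \sum_i \sum_j (u i 0 * v j 0) *: wedge (blade [set i]%SET) (blade [set j]%SET).
Proof.
rewrite [vect u]/vect wedge_suml; apply: eq_bigr => i _.
rewrite [vect v]/vect wedge_sumr; apply: eq_bigr => j _.
by rewrite wedgeZl wedgeZr scalerA.
Qed.

Lemma mdot_wedge_vect a b c d :
  mdot (wedge (vect a) (vect b)) (wedge (vect c) (vect d) : mvec R n) =
  vdot a c * vdot b d - vdot a d * vdot b c.
Proof.
rewrite (wedge_vect_expand a b) mdot_suml.
rewrite /vdot !big_distrlr -sumrB; apply: eq_bigr => i _ /=.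
rewrite -sumrB mdot_suml; apply: eq_bigr => j _; rewrite mdotZl.
transitivity (a i 0 * b j 0 * (c i 0 * d j 0 - d i 0 * c j 0)); last first.
  by ring.
congr (_ * _); rewrite wedge_vect_expand mdot_sumr.
rewrite -[c i 0 * d j 0](sum_delta2 (fun k l => c k 0 * d l 0)).
(* After the commutation both products sample the same function of (k, l), at (i, j) and at (j, i),
   so the two double sums merge. *)
rewrite -[d i 0 * c j 0]mulrC -[c j 0 * d i 0](sum_delta2 (fun k l => c k 0 * d
  l 0)).
rewrite -sumrB; apply: eq_bigr => k _; rewrite mdot_sumr -sumrB.
by apply: eq_bigr => l _; rewrite mdotZr mdot_wedge_blade1; ring.
Qed.

(** * Bivectors and adjointness on them *)

Lemma bivector0 : bivector (0 : mvec R n).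
Proof. by move=> S _; rewrite coef0. Qed.

Lemma bivectorD X Y : bivector X -> bivector Y -> bivector (X + Y).
Proof. by move=> bX bY S S2; rewrite coefD bX// bY// addr0. Qed.

Lemma bivectorZ (k : R) X : bivector X -> bivector (k *: X).
Proof. by move=> bX S S2; rewrite coefZ bX// mulr0. Qed.

Lemma bivector_wedge u v : bivector (wedge (vect u) (vect v)).
Proof.
rewrite wedge_vect_expand => S S2; rewrite coef_sum big1// => i _.
rewrite coef_sum big1// => j _; rewrite coefZ wedge_blade disjoints1 inE.
case: ifP => ij; rewrite ?coef0 ?mulr0// coefZ coef_blade.
have [SE|_] := eqVneq; last by rewrite !mulr0.
by rewrite SE cards2 ij in S2.
Qed.

(** Products of two vectors span the bivectors, since every blade of size 2 is one up to sign. *)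
Lemma bivector_ind (P : mvec R n -> Prop) :
  P 0 -> (forall X Y, P X -> P Y -> P (X + Y)) ->
  (forall (k : R) X, P X -> P (k *: X)) ->
  (forall u v, P (wedge (vect u) (vect v))) ->
  forall X, bivector X -> P X.
Proof.
move=> P0 PD PZ Pw X bX; rewrite (blade_sum X).
apply: (@big_ind _ P) => // S _; have [S2|S2] := boolP (#|S| == 2%N); last first.
  by rewrite bX// scale0r.
by have /cards2P[i [j [ij ->]]] := S2; rewrite blade2//; do 2 apply: (PZ).
Qed.

Lemma bivector_outer t X : bivector X -> bivector (outer t X).
Proof.
move: X; apply: bivector_ind => [|X Y|k X|u v].
- by rewrite outer0; exact: bivector0.
- by rewrite outerD; exact: bivectorD.
- by rewrite outerZ; exact: bivectorZ.
- by rewrite outer_wedge !outer_vect; exact: bivector_wedge.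
Qed.

Lemma bivector_eq X Y : bivector X -> bivector Y ->
  (forall u v, mdot X (wedge (vect u) (vect v)) = mdot Y (wedge (vect u) (vect
    v))) ->
  X = Y.
Proof.
move=> bX bY XY; apply/coefP => S; have [|S2] := boolP (#|S| == 2%N); last first.
  by rewrite bX ?bY.
by move=> /cards2P[i [j [ij ->]]]; rewrite -!mdot_blade blade2// !mdotZr XY.
Qed.

Lemma vdot_trmx t a b : vdot (t^T *m a) b = vdot a (t *m b).
Proof.
have vE u v : vdot u v = (u^T *m v) 0 0.
  by rewrite mxE; apply: eq_bigr => i _; rewrite mxE.
by rewrite !vE trmx_mul trmxK mulmxA.
Qed.

(** Once X is itself a product of two vectors, both sides are Gram determinants, and adjointness on
    V acts entry by entry. *)
Lemma mdot_outer_trmx t X u v : bivector X ->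
  mdot (outer t^T X) (wedge (vect u) (vect v)) =
  mdot X (outer t (wedge (vect u) (vect v))).
Proof.
move: X; apply: bivector_ind => [|X Y XE YE|k X XE|a b].
- by rewrite outer0 !mdot0l.
- by rewrite outerD !mdotDl XE YE.
- by rewrite outerZ !mdotZl XE.
- by rewrite !outer_wedge !outer_vect !mdot_wedge_vect !vdot_trmx.
Qed.

End ExteriorAlgebra.
(** * Smooth functions on an open set *)

Section SmoothCalculus.
Context {R : realType} {V : normedModType R} {U : set V} (HU : open U).

(** Openness turns agreement on U into agreement of germs, which is what derivatives see. *)
Lemma open_near_eq {W : Type} (f g : V -> W) x :
  (forall y, U y -> f y = g y) -> U x -> \near x, f x = g x.
Proof. by move=> fg Ux; apply: filterS (open_nbhs_nbhs (conj HU Ux)). Qed.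

Lemma derive_eq_on {W : normedModType R} (f g : V -> W) v x :
  (forall y, U y -> f y = g y) -> U x -> 'D_v f x = 'D_v g x.
Proof. by move=> fg Ux; apply: near_eq_derive; exact: open_near_eq. Qed.

(** The first-order expansion of f is also one for g; uniqueness of the differential then identifies
    ['d g x] with ['d f x], whose continuity is known. *)
Lemma differentiable_eq_on {W : normedModType R} (f g : V -> W) x :
  (forall y, U y -> f y = g y) -> U x -> differentiable f x -> differentiable g x.
Proof.
move=> fg Ux fd.
have gE : g \o shift x = cst (g x) + 'd f x +o_ 0 id.
  have /eqaddoP fE := diff_locally fd.
  apply/eqaddoP => e e0; have := fE e e0.
  have nU : \forall y \near 0, U (y + x).
    have : \forall y \near x, U y := open_nbhs_nbhs (conj HU Ux).
    by rewrite (near_shift 0 x) subr0.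
  apply: filterS2 nU => y Uy.
  suff -> : (g \o shift x - (cst (g x) + 'd f x)) y =
    (f \o shift x - (cst (f x) + 'd f x)) y by [].
  by rewrite !fctE -!fg.
have dgE : 'd g x = 'd f x :> (V -> W).
  by apply: diff_unique gE; exact: diff_continuous.
apply/diff_locallyP; split; last by rewrite dgE.
by rewrite dgE; exact: diff_continuous.
Qed.

(** Allows each closure property below to establish its derivative formula only at points of U. *)
Lemma Ck_eq_on {W : normedModType R} k (f g : V -> W) :
  (forall y, U y -> f y = g y) -> Ck k U f -> Ck k U g.
Proof.
elim: k f g => [|k IHk] f g fg /=.
  move=> fc x Ux; have := fc x Ux; rewrite /prop_for /continuous_at fg//.
  by apply: cvg_trans; apply: near_eq_cvg; exact: open_near_eq.
move=> [fd fD]; split=> [x Ux|v]; first exact: differentiable_eq_on fg Ux (fd x Ux).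
by apply: (IHk) (fD v) => y Uy; exact: derive_eq_on.
Qed.

Arguments Ck_eq_on {W} [k] f [g].

(** The recursion of [Ck] asks for continuity at level 0 only; differentiability supplies it from
    level 1. *)
Lemma CkS {W : normedModType R} k (f : V -> W) : Ck k.+1 U f -> Ck k U f.
Proof.
elim: k f => [|k IHk] f /= [fd fD].
  by move=> x Ux; exact: differentiable_continuous (fd x Ux).
by split=> // v; exact: IHk.
Qed.

Lemma Ck_cst {W : normedModType R} k (w : W) : Ck k U (fun=> w).
Proof.
elim: k w => [|k IHk] w /=; first by move=> x _; exact: cvg_cst.
split=> [x _|v]; first exact: differentiable_cst.
apply: (Ck_eq_on (fun=> 0)) (IHk 0) => y _; by rewrite derive_cst.
Qed.

Lemma Ck_add {W : normedModType R} k (f g : V -> W) :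
  Ck k U f -> Ck k U g -> Ck k U (fun x => f x + g x).
Proof.
elim: k f g => [|k IHk] f g /=.
  by move=> fc gc x Ux; apply: continuousD; [exact: fc|exact: gc].
move=> [fd fD] [gd gD]; split=> [x Ux|v].
  by apply: differentiableD; [exact: fd|exact: gd].
apply: Ck_eq_on (IHk _ _ (fD v) (gD v)) => y Uy.
by rewrite deriveD//; apply: diff_derivable; [exact: fd|exact: gd].
Qed.

Lemma Ck_linear {W W' : normedModType R} k (L : {linear W -> W'}) (f : V -> W) :
  continuous L -> Ck k U f -> Ck k U (fun x => L (f x)).
Proof.
move=> Lc; elim: k f => [|k IHk] f /=.
  move=> fc x Ux; apply: continuous_comp; [exact: fc|exact: Lc].
move=> [fd fD]; split=> [x Ux|v].
  by apply: differentiable_comp; [exact: fd|exact: linear_differentiable].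
apply: Ck_eq_on (IHk _ (fD v)) => y Uy.
have Ld : differentiable L (f y) by exact: linear_differentiable.
have fyd := fd y Uy.
rewrite [RHS]deriveE; last exact: differentiable_comp.
by rewrite diff_comp//= diff_lin// deriveE.
Qed.

Lemma Ck_mul k (f g : V -> R) : Ck k U f -> Ck k U g -> Ck k U (fun x => f x * g x).
Proof.
elim: k f g => [|k IHk] f g.
  by move=> fc gc x Ux; apply: continuousM; [exact: fc|exact: gc].
(* The product rule leaves one factor undifferentiated, so that factor is lowered by one order to
   meet the induction hypothesis. *)
move=> fS gS; have fk := CkS _ _ fS; have gk := CkS _ _ gS.
have [fd fD] := fS; have [gd gD] := gS; split=> [x Ux|v].
  by apply: differentiableM; [exact: fd|exact: gd].
apply: Ck_eq_on (Ck_add _ _ _ (IHk _ _ fk (gD v)) (IHk _ _ gk (fD v))) => y Uy.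
by rewrite deriveM//; apply: diff_derivable; [exact: fd|exact: gd].
Qed.

(** A bootstrap: the derivative is minus the squared inverse times the derivative of f, and involves
    the inverse only at the previous order. *)
Lemma Ck_inv k (f : V -> R) : (forall x, U x -> f x != 0) ->
  Ck k U f -> Ck k U (fun x => (f x)^-1).
Proof.
move=> f0; elim: k => [|k IHk].
  by move=> fc x Ux; apply: continuousV; [exact: f0|exact: fc].
move=> fS; have fk := CkS _ _ fS; have [fd fD] := fS; split=> [x Ux|v].
  by apply: differentiableV; [exact: fd|exact: f0].
have ik := IHk fk.
have C := Ck_mul _ _ _ (Ck_mul _ _ _ (Ck_cst k (-1 : R)) (Ck_mul _ _ _ ik ik))
  (fD v).
apply: (Ck_eq_on _ _ C) => y Uy; rewrite deriveV; [|exact: f0|].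
  by rewrite -[_ *: _]/(_ * _) -invfM -expr2 mulN1r.
by apply: diff_derivable; exact: fd.
Qed.

Lemma Ck_coord m p k (f : V -> 'M[R]_(m, p)) i j :
  Ck k U f -> Ck k U (fun x => f x i j).
Proof.
have cl : linear (fun M : 'M[R]_(m, p) => M i j) by move=> a M N; rewrite !mxE.
pose L : {linear 'M[R]_(m, p) -> R} := HB.pack (fun M : 'M[R]_(m, p) => M i j)
  (GRing.isLinear.Build _ _ _ _ _ cl).
by apply: (Ck_linear _ L); exact: coord_continuous.
Qed.

Lemma Ck_scalel {W : normedModType R} k (f : V -> R) (w : W) :
  Ck k U f -> Ck k U (fun x => f x *: w).
Proof.
have cl : linear (fun r : R => r *: w) by move=> a r s; rewrite scalerDl scalerA.
pose L : {linear R -> W} := HB.pack (fun r : R => r *: w)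
  (GRing.isLinear.Build _ _ _ _ _ cl).
by apply: (Ck_linear _ L); exact: scalel_continuous.
Qed.

Lemma Ck_sum {W : normedModType R} k I (r : seq I) (P : pred I) (F : I -> V -> W) :
  (forall i, P i -> Ck k U (F i)) -> Ck k U (fun x => \sum_(i <- r | P i) F i x).
Proof.
move=> FC; elim: r => [|i r IHr].
  by apply: Ck_eq_on (Ck_cst k (0 : W)) => y _; rewrite big_nil.
have [Pi|Pi] := boolP (P i).
  by apply: Ck_eq_on (Ck_add _ _ _ (FC i Pi) IHr) => y _; rewrite big_cons Pi.
by apply: Ck_eq_on IHr => y _; rewrite big_cons (negbTE Pi).
Qed.

Lemma Ck_prod k I (r : seq I) (P : pred I) (F : I -> V -> R) :
  (forall i, P i -> Ck k U (F i)) -> Ck k U (fun x => \prod_(i <- r | P i) F i x).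
Proof.
move=> FC; elim: r => [|i r IHr].
  by apply: Ck_eq_on (Ck_cst k (1 : R)) => y _; rewrite big_nil.
have [Pi|Pi] := boolP (P i).
  by apply: Ck_eq_on (Ck_mul _ _ _ (FC i Pi) IHr) => y _; rewrite big_cons Pi.
by apply: Ck_eq_on IHr => y _; rewrite big_cons (negbTE Pi).
Qed.

Lemma Ck_mx m p k (f : V -> 'M[R]_(m, p)) :
  (forall i j, Ck k U (fun x => f x i j)) -> Ck k U f.
Proof.
move=> fC; apply: (Ck_eq_on (fun x => \sum_i \sum_j f x i j *: delta_mx i j))
  => [y _|].
  by rewrite [RHS]matrix_sum_delta.
by apply: Ck_sum => i _; apply: Ck_sum => j _; exact: Ck_scalel.
Qed.

Lemma smooth_det m (f : V -> 'M[R]_m) :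
  smooth U f -> smooth U (fun x => \det (f x)).
Proof.
move=> fC k; rewrite /determinant; apply: Ck_sum => s _; apply: Ck_mul.
  exact: Ck_cst.
by apply: Ck_prod => i _; exact: Ck_coord.
Qed.

(** Cramer's rule: the entries are cofactors divided by a nonvanishing determinant. *)
Lemma smooth_invmx m (f : V -> 'M[R]_m) : (forall x, U x -> f x \in unitmx) ->
  smooth U f -> smooth U (fun x => invmx (f x)).
Proof.
move=> fu fC k.
apply: (Ck_eq_on (fun x => (\det (f x))^-1 *: \adj (f x))) => [y Uy|].
  by rewrite /invmx fu.
apply: Ck_mx => i j; apply: (Ck_eq_on (fun x => (\det (f x))^-1 * (\adj (f x))
  i j)).
  by move=> y _; rewrite [RHS]mxE.
apply: Ck_mul.
  apply: Ck_inv; last exact: smooth_det.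
  by move=> x Ux; have := fu x Ux; rewrite unitmxE unitfE.
apply: (Ck_eq_on (fun x => cofactor (f x) j i)) => [y _|]; first by rewrite mxE.
rewrite /cofactor; apply: Ck_mul; first exact: Ck_cst.
apply: smooth_det => k'; apply: Ck_mx => i' j'.
apply: (Ck_eq_on (fun x => f x (lift j i') (lift i j'))) => [y _|].
  by rewrite !mxE.
exact: Ck_coord.
Qed.

Lemma smooth_mulmx m p q (f : V -> 'M[R]_(m, p)) (g : V -> 'M[R]_(p, q)) :
  smooth U f -> smooth U g -> smooth U (fun x => f x *m g x).
Proof.
move=> fC gC k; apply: Ck_mx => i j.
apply: (Ck_eq_on (fun x => \sum_l f x i l * g x l j)) => [y _|]; first by
  rewrite mxE.
by apply: Ck_sum => l _; apply: Ck_mul; exact: Ck_coord.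
Qed.

End SmoothCalculus.

Arguments Ck_eq_on {R V U} HU {W} [k] f [g].

(** * Fields, connections and their deformation *)

Section Fields.
Context {R : realType} {n : nat} {U : set 'cV[R]_n} (HU : open U).
Local Notation V := 'cV[R]_n.

Lemma smooth_differentiable {W : normedModType R} (f : V -> W) x :
  smooth U f -> U x -> differentiable f x.
Proof. by move=> fS; have [fd _] := fS 1%N; exact: fd. Qed.

Lemma smooth_derive {W : normedModType R} (f : V -> W) v :
  smooth U f -> smooth U ('D_v f).
Proof. by move=> fS k; have [_ fD] := fS k.+1; exact: fD. Qed.

Lemma smooth_scale m p (f : V -> R) (F : V -> 'M[R]_(m, p)) :
  smooth U f -> smooth U F -> smooth U (fun x => f x *: F x).
Proof.
move=> fS FS k; apply: (Ck_mx HU) => i j.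
apply: (Ck_eq_on HU (fun x => f x * F x i j)) => [y _|]; first by rewrite mxE.
by apply: (Ck_mul HU) => //; exact: (Ck_coord HU).
Qed.

(** Smoothness speaks of derivatives in fixed directions; this expansion carries it over to
    derivatives along a vector field. *)
Lemma derive_sum_coord {W : normedModType R} (f : V -> W) x (v : V) :
  differentiable f x -> 'D_v f x = \sum_i v i 0 *: 'D_(delta_mx i 0) f x.
Proof.
move=> fd; rewrite deriveE// {1}[v]matrix_sum_delta linear_sum.
by apply: eq_bigr => i _; rewrite big_ord1 linearZ deriveE.
Qed.

Lemma derive_mulmx m p q (f : V -> 'M[R]_(m, p)) (g : V -> 'M[R]_(p, q)) x v :
  smooth U f -> smooth U g -> U x ->
  'D_v (fun y => f y *m g y) x = 'D_v f x *m g x + f x *m 'D_v g x.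
Proof.
move=> fS gS Ux.
have dv r s (k : V -> 'M[R]_(r, s)) : smooth U k -> derivable k x v.
  by move=> kS; apply: diff_derivable; exact: smooth_differentiable.
have fd := dv _ _ _ fS; have gd := dv _ _ _ gS.
rewrite derive_mx; last by apply: dv; exact: smooth_mulmx.
apply/matrixP => i j; rewrite !mxE.
have -> : (fun y => (f y *m g y) i j) =
    \sum_(l < p) ((fun y => f y i l) * (fun y => g y l j)).
  by apply/funext => y; rewrite fct_sumE mxE.
have fid l : derivable (fun y => f y i l) x v by move/derivable_mxP: fd.
have gid l : derivable (fun y => g y l j) x v by move/derivable_mxP: gd.
rewrite derive_sum => [|l]; last exact: derivableM.
rewrite -big_split; apply: eq_bigr => l _ /=.
rewrite deriveM// (derive_mx fd) (derive_mx gd) !mxE addrC.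
by congr (_ + _); rewrite -[LHS]/(_ * _) mulrC.
Qed.

Lemma smooth_cst {W : normedModType R} (w : W) : smooth U (fun=> w).
Proof. by move=> k; exact: (Ck_cst HU). Qed.

Lemma smooth_derive_along m p (f : V -> 'M[R]_(m, p)) (a : V -> V) :
  smooth U a -> smooth U f -> smooth U (fun x => 'D_(a x) f x).
Proof.
move=> aS fS k.
apply: (Ck_eq_on HU (fun x => \sum_i a x i 0 *: 'D_(delta_mx i 0) f x)).
  by move=> y Uy; rewrite -derive_sum_coord//; exact: smooth_differentiable.
apply: (Ck_sum HU) => i _; apply: smooth_scale; last exact: smooth_derive.
by move=> l; exact: (Ck_coord HU).
Qed.

Lemma smooth_add m p (f g : V -> 'M[R]_(m, p)) :
  smooth U f -> smooth U g -> smooth U (fun x => f x + g x).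
Proof. by move=> fS gS k; exact: (Ck_add HU). Qed.

Section Connection.
Variables (gamma : V -> V -> V -> V) (Hgamma : connection_field U gamma).

Lemma connection_linearl x k u v w : U x ->
  gamma x (k *: u + v) w = k *: gamma x u w + gamma x v w.
Proof. by move=> Ux; have [Hl _] := Hgamma.1 x Ux; exact: (Hl w k u v). Qed.

Lemma connection_linearr x k u v w : U x ->
  gamma x u (k *: v + w) = k *: gamma x u v + gamma x u w.
Proof. by move=> Ux; have [_ Hr] := Hgamma.1 x Ux; exact: (Hr u k v w). Qed.

Lemma connectionDl x u v w : U x -> gamma x (u + v) w = gamma x u w + gamma x v w.
Proof. by move=> Ux; rewrite -[u]scale1r connection_linearl// !scale1r. Qed.

Lemma connectionDr x u v w : U x -> gamma x u (v + w) = gamma x u v + gamma x u w.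
Proof. by move=> Ux; rewrite -[v]scale1r connection_linearr// !scale1r. Qed.

Lemma connection0l x v : U x -> gamma x 0 v = 0.
Proof.
by move=> Ux; apply: (addrI (gamma x 0 v)); rewrite -connectionDl// !addr0.
Qed.

Lemma connection0r x u : U x -> gamma x u 0 = 0.
Proof.
by move=> Ux; apply: (addrI (gamma x u 0)); rewrite -connectionDr// !addr0.
Qed.

Lemma connectionZl x k u v : U x -> gamma x (k *: u) v = k *: gamma x u v.
Proof.
by move=> Ux; rewrite -[k *: u]addr0 connection_linearl// connection0l// addr0.
Qed.

Lemma connectionZr x k u v : U x -> gamma x u (k *: v) = k *: gamma x u v.
Proof.
by move=> Ux; rewrite -[k *: v]addr0 connection_linearr// connection0r// addr0.
Qed.

(** Expansion in Christoffel coefficients. [connection_field] gives smoothness on constant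
    arguments, and this form extends it to fields. *)
Lemma connection_sum x u v : U x ->
  gamma x u v = \sum_i \sum_j (u i 0 * v j 0) *: gamma x (delta_mx i 0)
    (delta_mx j 0).
Proof.
move=> Ux; rewrite {1}[u]matrix_sum_delta {1}[v]matrix_sum_delta.
rewrite (big_morph (gamma x ^~ _) (fun u v => connectionDl _ u v _ Ux)
  (connection0l _ _ Ux)).
apply: eq_bigr => i _; rewrite big_ord1.
rewrite (big_morph (gamma x _) (fun v w => connectionDr _ _ v w Ux)
  (connection0r _ _ Ux)).
by apply: eq_bigr => j _; rewrite big_ord1 connectionZl// connectionZr// scalerA.
Qed.

Lemma smooth_connection (a b : V -> V) : smooth U a -> smooth U b ->
  smooth U (fun x => gamma x (a x) (b x)).
Proof.
move=> aS bS k; apply: (Ck_eq_on HU (fun x => \sum_i \sum_j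
  (a x i 0 * b x j 0) *: gamma x (delta_mx i 0) (delta_mx j 0))).
  by move=> y Uy; rewrite -connection_sum.
apply: (Ck_sum HU) => i _; apply: (Ck_sum HU) => j _.
apply: smooth_scale => [l|]; last exact: Hgamma.2.
by apply: (Ck_mul HU); exact: (Ck_coord HU).
Qed.

Lemma smooth_cov_vec (a b : V -> V) : smooth U a -> smooth U b ->
  smooth U (cov_vec gamma a b).
Proof.
move=> aS bS; apply: smooth_add; first exact: smooth_derive_along.
exact: smooth_connection.
Qed.

Lemma cov_vec_eq_on (a b c : V -> V) x :
  (forall y, U y -> b y = c y) -> U x -> cov_vec gamma a b x = cov_vec gamma a c x.
Proof. by move=> bc Ux; rewrite /cov_vec (derive_eq_on HU b c)// bc. Qed.

End Connection.

Lemma smooth_lie_bracket (a b : V -> V) : smooth U a -> smooth U b ->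
  smooth U (lie_bracket a b).
Proof.
move=> aS bS k.
apply: (Ck_eq_on HU (fun x => 'D_(a x) b x + (-1) *: 'D_(b x) a x)).
  by move=> y Uy; rewrite scaleN1r.
apply: smooth_add; first exact: smooth_derive_along.
by apply: smooth_scale; [exact: smooth_cst|exact: smooth_derive_along].
Qed.

Lemma smooth_wedge (X Y : V -> mvec R n) : smooth U X -> smooth U Y ->
  smooth U (fun x => wedge (X x) (Y x)).
Proof.
move=> XS YS k; apply: (Ck_sum HU) => A _; apply: (Ck_sum HU) => B _.
apply: (Ck_scalel HU); apply: (Ck_mul HU); last exact: (Ck_coord HU).
by apply: (Ck_mul HU); [exact: (Ck_cst HU)|exact: (Ck_coord HU)].
Qed.

Lemma smooth_vect (b : V -> V) : smooth U b -> smooth U (fun x => vect (b x)).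
Proof.
move=> bS k; apply: (Ck_sum HU) => i _.
by apply: (Ck_scalel HU); exact: (Ck_coord HU).
Qed.

Lemma smooth_outer (t : V -> 'M[R]_n) (X : V -> mvec R n) :
  smooth U t -> smooth U X -> smooth U (fun x => outer (t x) (X x)).
Proof.
move=> tS XS k; apply: (Ck_sum HU) => S _; apply: smooth_scale => [l|].
  exact: (Ck_coord HU).
elim: (enum S) => [|i r IHr] l.
  by apply: (Ck_eq_on HU (fun=> scal 1)) => [y _|]; rewrite ?big_nil//; exact:
    (Ck_cst HU).
apply: (Ck_eq_on HU (fun y => wedge (vect (col i (t y)))
   (\big[wedge/scal 1]_(i <- r) vect (col i (t y))))) => [y _|].
  by rewrite big_cons.
apply: smooth_wedge => //; apply: smooth_vect => l'.
apply: (Ck_eq_on HU (fun y => t y *m delta_mx i 0)) => [y _|]; first by rewrite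
  colE.
by apply: (smooth_mulmx HU) => //; exact: smooth_cst.
Qed.

End Fields.

(** * Pointwise linearity of a Riemann field on bivectors *)

Section RiemannLinear.
Context {R : realType} {n : nat} {U : set 'cV[R]_n}.
Variables (gamma : 'cV[R]_n -> 'cV[R]_n -> 'cV[R]_n -> 'cV[R]_n)
  (g : 'cV[R]_n -> 'M[R]_n) (Rm : 'cV[R]_n -> mvec R n -> mvec R n).
Hypothesis HRm : riemann_field U gamma g Rm.

Lemma riemann0 x : U x -> Rm x 0 = 0.
Proof.
(* With coefficient -1 and both bivectors zero, the right-hand side cancels. *)
move=> Ux; have := riemann_linear HRm (-1) Ux bivector0 bivector0.
by rewrite scaler0 addr0 scaleN1r addNr.
Qed.

Lemma riemannD x B C : U x -> bivector B -> bivector C ->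
  Rm x (B + C) = Rm x B + Rm x C.
Proof.
by move=> Ux bB bC; have := riemann_linear HRm 1 Ux bB bC; rewrite !scale1r.
Qed.

Lemma riemannZ x k B : U x -> bivector B -> Rm x (k *: B) = k *: Rm x B.
Proof.
move=> Ux bB; have := riemann_linear HRm k Ux bB bivector0.
by rewrite !addr0 riemann0// addr0.
Qed.

End RiemannLinear.
Arguments riemann0 {R n U} [gamma g Rm].
Arguments riemannD {R n U} [gamma g Rm].
Arguments riemannZ {R n U} [gamma g Rm].

(** * The geometric structure carried by the deformation *)

Section Deformation.
Context {R : realType} {n : nat} {U : set 'cV[R]_n} (HU : open U).
Local Notation V := 'cV[R]_n.
Variables (gamma : V -> V -> V -> V) (h : V -> 'M[R]_n).
Hypotheses (Hgamma : connection_field U gamma) (hS : smooth U h)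
  (hU : forall x, U x -> h x \in unitmx).

(** The deformed derivative of the constant field v: its ordinary derivative vanishes, so what
    remains is the connection term. *)
Definition deformed_connection (x u v : V) : V :=
  h x *m cov_vec gamma (fun=> u) (fun y => invmx (h y) *m v) x.

Lemma smooth_invmx_mul (b : V -> V) : smooth U b ->
  smooth U (fun y => invmx (h y) *m b y).
Proof. by move=> bS; apply: (smooth_mulmx HU) => //; exact: (smooth_invmx HU). Qed.

Lemma deformed_cov_vec (a b : V -> V) x : smooth U b -> U x ->
  cov_vec deformed_connection a b x =
  h x *m cov_vec gamma a (fun y => invmx (h y) *m b y) x.
Proof.
move=> bS Ux; have iS := smooth_invmx HU _ h hU hS.
rewrite /cov_vec /deformed_connection /cov_vec.
rewrite (derive_mulmx HU _ _ _ (fun y => invmx (h y)) (fun=> b x))//; last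
  exact: smooth_cst.
rewrite (derive_mulmx HU _ _ _ (fun y => invmx (h y)) b)//.
rewrite derive_cst mulmx0 addr0 !mulmxDr mulKVmx ?hU//.
by rewrite addrCA addrA.
Qed.

Lemma deformed_connection_field : connection_field U deformed_connection.
Proof.
split=> [x Ux|u v]; last first.
  apply: (smooth_mulmx HU) => //; apply: smooth_cov_vec => //; first exact:
    smooth_cst.
  by apply: smooth_invmx_mul; exact: smooth_cst.
have iS (v : V) : smooth U (fun y => invmx (h y) *m v).
  by apply: smooth_invmx_mul; exact: smooth_cst.
have id (v : V) : differentiable (fun y => invmx (h y) *m v) x.
  exact: smooth_differentiable (iS v) Ux.
suff linl_linr : (forall (w : V) k (u v : V),
      deformed_connection x (k *: u + v) w =
      k *: deformed_connection x u w + deformed_connection x v w) /\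
    (forall (u : V) k (v w : V), deformed_connection x u (k *: v + w) =
      k *: deformed_connection x u v + deformed_connection x u w).
  by split=> [w k u v|u k v w]; [exact: linl_linr.1|exact: linl_linr.2].
rewrite /deformed_connection /cov_vec; split=> [w k u v|u k v w].
  (* Linearity in the direction comes from writing the derivative as a differential. *)
  rewrite !deriveE// linearP (connection_linearl _ Hgamma)//.
  by rewrite scalemxAr -mulmxDr scalerDr addrACA.
have -> : invmx (h x) *m (k *: v + w) = k *: (invmx (h x) *m v) + invmx (h x) *m w.
  by rewrite mulmxDr -scalemxAr.
rewrite (connection_linearr _ Hgamma)//.
have -> : (fun y => invmx (h y) *m (k *: v + w)) =
    k \*: (fun y => invmx (h y) *m v) + (fun y => invmx (h y) *m w).
  by apply/funext => y; rewrite mulmxDr -scalemxAr.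
rewrite deriveD ?deriveZ//; try exact: diff_derivable.
  by rewrite scalemxAr -mulmxDr scalerDr addrACA.
by apply: derivableZ; exact: diff_derivable.
Qed.

Variables (g : V -> 'M[R]_n) (eta : 'M[R]_n).
Hypotheses (gE : forall x, U x -> g x = (h x)^T *m eta *m h x).

(** [h x] is an isometry from [g x] to [eta]; compatibility and the pairing with curvature are
    transported along it. *)
Lemma gdot_gauge x u v : U x -> gdot (g x) u v = gdot eta (h x *m u) (h x *m v).
Proof. by move=> Ux; rewrite /gdot gE// -!mulmxA vdot_trmx. Qed.

Lemma deformed_compatible : compatible U gamma g ->
  compatible U deformed_connection (fun=> eta).
Proof.
move=> Hc a b c aS bS cS x Ux.
have iK y u : U y -> h y *m (invmx (h y) *m u) = u.
  by move=> Uy; rewrite mulKVmx// hU.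
(* On U, the g-product of h^-1 b and h^-1 c is the eta-product of b and c. *)
have := Hc a _ _ aS (smooth_invmx_mul b bS) (smooth_invmx_mul c cS) x Ux.
rewrite !gdot_gauge// !iK// -!deformed_cov_vec// => <-.
by apply: (derive_eq_on HU) => // y Uy; rewrite gdot_gauge// !iK.
Qed.

Variable D : (V -> V) -> (V -> mvec R n) -> V -> mvec R n.
Hypothesis HD : covariant_derivative U gamma D.

Lemma deformation_covariant_derivative :
  covariant_derivative U deformed_connection (deformation h D).
Proof.
have [Ds Dv Da Dw] := HD; have iS := smooth_invmx HU _ h hU hS.
have oS X : smooth U X -> smooth U (fun y => outer (invmx (h y)) (X y)).
  by move=> XS; exact: (smooth_outer HU).
rewrite /deformation; split=> [a f aS fS x Ux|a b aS bS x Ux|a X Y aS XS YS x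
  Ux|a X Y aS XS YS x Ux].
- under eq_fun do rewrite outer_scal.
  by rewrite Ds// outer_scal.
- under eq_fun do rewrite outer_vect.
  by rewrite Dv ?outer_vect ?deformed_cov_vec//; exact: smooth_invmx_mul.
- under eq_fun do rewrite outerD.
  by rewrite Da ?outerD//; exact: oS.
- under eq_fun do rewrite outer_wedge.
  rewrite Dw ?outerD ?outer_wedge//; try exact: oS.
  (* The factor left undifferentiated has passed through h^-1 and then h, and is restored. *)
  by rewrite -!outerM mulmxV ?hU// !outer1.
Qed.

(** * Curvature and Riemann fields under deformation *)

Section Curvature.
Variable gamma_eta : V -> V -> V -> V.
Hypothesis Hgamma_eta : connection_field U gamma_eta.
Hypothesis HD_eta : covariant_derivative U gamma_eta (deformation h D).

(** Holds for any connection whose covariant derivative is the deformation, since injectivity of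
    [vect] lets the clause on vector fields determine [cov_vec]. *)
Lemma cov_vec_deformation (a b : V -> V) x : smooth U a -> smooth U b -> U x ->
  cov_vec gamma_eta a b x = h x *m cov_vec gamma a (fun y => invmx (h y) *m b y) x.
Proof.
move=> aS bS Ux; apply: vect_inj; rewrite -(cov_vect HD_eta)// /deformation.
under eq_fun do rewrite outer_vect.
by rewrite (cov_vect HD)// ?outer_vect//; exact: smooth_invmx_mul.
Qed.

(** On fields of the form h c the deformed derivative again yields h times a field, so inner factors
    h^-1 h cancel. The Lie bracket is the same for both connections. *)
Lemma curvature_deformation (a b c : V -> V) x :
  smooth U a -> smooth U b -> smooth U c -> U x ->
  curvature gamma_eta a b (fun y => h y *m c y) x = h x *m curvature gamma a b c x.
Proof.
move=> aS bS cS Ux.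
have hcS : smooth U (fun y => h y *m c y) by exact: (smooth_mulmx HU).
have iK y u : U y -> invmx (h y) *m (h y *m u) = u.
  by move=> Uy; rewrite mulKmx// hU.
have cov1 (e : V -> V) y : smooth U e -> U y ->
    cov_vec gamma_eta e (fun y => h y *m c y) y = h y *m cov_vec gamma e c y.
  move=> eS Uy; rewrite cov_vec_deformation//; congr (_ *m _).
  by apply: (cov_vec_eq_on HU) => // z Uz; rewrite iK.
have cov2 (d e : V -> V) : smooth U d -> smooth U e ->
    cov_vec gamma_eta d (cov_vec gamma_eta e (fun y => h y *m c y)) x =
    h x *m cov_vec gamma d (cov_vec gamma e c) x.
  move=> dS eS; rewrite cov_vec_deformation//; last exact: smooth_cov_vec.
  congr (_ *m _); apply: (cov_vec_eq_on HU) => // z Uz.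
  by rewrite cov1// iK.
rewrite /curvature !cov2// cov1//; last exact: smooth_lie_bracket.
by rewrite !mulmxBr.
Qed.

Lemma riemann_deformation (Rg Reta : V -> mvec R n -> mvec R n) x B :
  riemann_field U gamma g Rg -> riemann_field U gamma_eta (fun=> eta) Reta ->
  U x -> bivector B -> Rg x B = outer (h x)^T (Reta x B).
Proof.
move=> HRg HReta Ux bB.
(* The closure clauses of [bivector_ind] supply no bivector hypothesis, whereas linearity of the
   Riemann fields asks for one; the predicate carries it along. *)
suff [] : bivector B /\ Rg x B = outer (h x)^T (Reta x B) by [].
move: B bB.
apply: (bivector_ind (fun B => bivector B /\ Rg x B = outer (h x)^T (Reta x
  B))) => [|X Y [bX XE] [bY YE]|k X [bX XE]|u v].
- split; first exact: bivector0.
  by rewrite (riemann0 HRg)// (riemann0 HReta)// outer0.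
- split; first exact: bivectorD.
  by rewrite (riemannD HRg)// (riemannD HReta)// outerD XE YE.
- split; first exact: bivectorZ.
  by rewrite (riemannZ HRg)// (riemannZ HReta)// outerZ XE.
split; first exact: bivector_wedge.
have buv := bivector_wedge u v.
apply: bivector_eq => [||c d]; first exact: riemann_bivector HRg _ _ Ux buv.
  by apply: bivector_outer; exact: riemann_bivector HReta _ _ Ux buv.
rewrite mdot_outer_trmx; last exact: riemann_bivector HReta _ _ Ux buv.
have cS (w : V) : smooth U (fun=> w) by exact: smooth_cst.
have hcS : smooth U (fun y => h y *m c) by exact: (smooth_mulmx HU).
rewrite outer_wedge !outer_vect.
rewrite (riemann_curvature HRg (cS u) (cS v) (cS c) (cS d) Ux).
(* The third field is differentiated, so it must be h c near x; the fourth is only evaluated at x,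
   so it is frozen at [h x *m d]. *)
rewrite (riemann_curvature HReta (cS u) (cS v) hcS (cS (h x *m d)) Ux).
by rewrite gdot_gauge// (curvature_deformation _ _ (fun=> c)).
Qed.

End Curvature.

End Deformation.

Theorem mainTheorem1 (R : realType) (n : nat)
  (U : set 'cV[R]_n) (HU : open U)
  (gamma : 'cV[R]_n -> 'cV[R]_n -> 'cV[R]_n -> 'cV[R]_n)
  (g h : 'cV[R]_n -> 'M[R]_n) (eta : 'M[R]_n)
  (Hg : geometric_structure U gamma g)
  (Hh : gauge_metric_field U g h eta)
  (D : ('cV[R]_n -> 'cV[R]_n) -> ('cV[R]_n -> mvec R n) ->
       'cV[R]_n -> mvec R n)
  (HD : covariant_derivative U gamma D) :
  (exists gamma_eta : 'cV[R]_n -> 'cV[R]_n -> 'cV[R]_n -> 'cV[R]_n,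
     geometric_structure U gamma_eta (fun=> eta) /\
     covariant_derivative U gamma_eta (deformation h D)) /\
  (forall gamma_eta : 'cV[R]_n -> 'cV[R]_n -> 'cV[R]_n -> 'cV[R]_n,
     geometric_structure U gamma_eta (fun=> eta) ->
     covariant_derivative U gamma_eta (deformation h D) ->
   forall Rg Reta : 'cV[R]_n -> mvec R n -> mvec R n,
     riemann_field U gamma g Rg ->
     riemann_field U gamma_eta (fun=> eta) Reta ->
     (forall B : 'cV[R]_n -> mvec R n,
        smooth U B -> (forall x, U x -> bivector (B x)) ->
        forall x, U x -> Rg x (B x) = outer (h x)^T (Reta x (B x))) /\
     (flat U Reta -> flat U Rg)).
Proof.
have [Hgamma [_ _] Hcompat] := Hg; have [hS hU [etaU etaT _] _ gE] := Hh.
split.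
  exists (deformed_connection gamma h); split.
    split; first exact: deformed_connection_field.
      by split=> [|//]; exact: smooth_cst.
    exact: (deformed_compatible HU _ _ hS hU _ _ gE).
  exact: deformation_covariant_derivative.
move=> gamma_eta [Hgamma_eta _ _] HDeta Rg Reta HRg HReta.
have RE x B : U x -> bivector B -> Rg x B = outer (h x)^T (Reta x B).
  exact: (riemann_deformation HU _ _ hS hU _ _ gE _ HD _ Hgamma_eta HDeta
    _ _ _ _ HRg HReta).
split=> [B _ bB x Ux|flat_eta x B Ux bB]; first by rewrite RE//; exact: bB.
by rewrite RE// flat_eta// outer0.
Qed.
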